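(* Let $(L,[,\ldots,],\alpha=(\alpha_1,\ldots,\alpha_{n-1}))$ be an $n$-ary Hom-Nambu algebra with $n\ge 3$. Suppose for some $k\in\{1,\ldots,n-2\}$ there exist $a_i\in L$ for $1\le i\le k$ satisfying $$\alpha_i(a_i)=a_i\quad\text{for }1\le i\le k$$ and $$[a_1,\ldots,a_j,x_{j+1},\ldots,x_{n-1},a_j]=0\quad\text{for }1\le j\le k\text{ and all }x_l\in L.$$ Then $L_k=(L,[,\ldots,]_k,(\alpha_{k+1},\ldots,\alpha_{n-1}))$ is an $(n-k)$-ary Hom-Nambu algebra, where $$[x_{k+1},\ldots,x_n]_k=[a_1,\ldots,a_k,x_{k+1},\ldots,x_n]$$ for all $x_l\in L$. Moreover, if $L$ is multiplicative, then so is $L_k$.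
   Context: We work over a fixed field $\mathbf{k}$ of characteristic $0$. For an integer $n\ge 2$, an $n$-ary Hom-algebra $(V,[,\ldots,],\alpha=(\alpha_1,\ldots,\alpha_{n-1}))$ consists of a $\mathbf{k}$-module $V$, an $n$-linear map $[,\ldots,]\colon V^{\otimes n}\to V$, and linear maps $\alpha_i\colon V\to V$ ($1\le i\le n-1$), called twisting maps. It is multiplicative if $\alpha_1=\cdots=\alpha_{n-1}=\alpha$ and $\alpha\circ[,\ldots,]=[,\ldots,]\circ\alpha^{\otimes n}$. An $n$-ary Hom-Nambu algebra is an $n$-ary Hom-algebra satisfying the $n$-ary Hom-Nambu identity $$[\alpha_1(x_1),\ldots,\alpha_{n-1}(x_{n-1}),[y_1,\ldots,y_n]]=\sum_{i=1}^n[\alpha_1(y_1),\ldots,\alpha_{i-1}(y_{i-1}),[x_1,\ldots,x_{n-1},y_i],\alpha_i(y_{i+1}),\ldots,\alpha_{n-1}(y_n)]$$ for all $x_1,\ldots,x_{n-1},y_1,\ldots,y_n\in V$. *)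

(* Defs.v *)
From HB Require Import structures.
From mathcomp Require Import all_boot all_order all_algebra.

Set Implicit Arguments.
Unset Strict Implicit.
Unset Printing Implicit Defensive.

Import GRing.Theory.
Local Open Scope ring_scope.

(* All indices are 0-based: the arguments x_1, ..., x_n and the twisting maps *)
(* alpha_1, ..., alpha_{n-1} are indexed by 'I_n and 'I_n.-1.                 *)

(* The list s as an n-tuple. It is only applied to lists s of size n, where   *)
(* it is s itself; it avoids casts between provably equal sizes.              *)
Definition args (K : fieldType) (V : lmodType K) (n : nat) (s : seq V) :
  n.-tuple V := [tuple s`_i | i < n].

(* A linear map on the n-th tensor power of V, as an n-linear map on V^n. *)
Definition multilinear (K : fieldType) (V : lmodType K) (n : nat)
    (br : n.-tuple V -> V) : Prop :=
  forall (i : 'I_n) (x : n.-tuple V),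
    linear (fun v : V => br [tuple if j == i then v else tnth x j | j < n]).

(* In the i-th summand, unlift i j is None for j = i, and otherwise it is the *)
(* index j (if j < i) or j - 1 (if j > i) of the map applied to y_j.          *)
Definition hom_nambu_identity (K : fieldType) (V : lmodType K) (n : nat)
    (br : n.-tuple V -> V) (alpha : 'I_n.-1 -> {linear V -> V}) : Prop :=
  forall (x : n.-1.-tuple V) (y : n.-tuple V),
    br (args n (rcons [tuple alpha i (tnth x i) | i < n.-1] (br y))) =
    \sum_(i < n)
      br [tuple if unlift i j is Some j' then alpha j' (tnth y j)
                else br (args n (rcons x (tnth y i))) | j < n].

Record hom_nambu_algebra (K : fieldType) (V : lmodType K) (n : nat)
    (br : n.-tuple V -> V) (alpha : 'I_n.-1 -> {linear V -> V}) : Prop :=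
  HomNambuAlgebra {
    hom_nambu_arity : (2 <= n)%N;
    hom_nambu_multilinear : multilinear br;
    hom_nambu_identityP : hom_nambu_identity br alpha
  }.

Definition hom_multiplicative (K : fieldType) (V : lmodType K) (n : nat)
    (br : n.-tuple V -> V) (alpha : 'I_n.-1 -> {linear V -> V}) : Prop :=
  exists2 alpha0 : {linear V -> V},
    forall i : 'I_n.-1, alpha i =1 alpha0 &
    forall x : n.-tuple V, alpha0 (br x) = br (map_tuple alpha0 x).

Definition bracket_k (K : fieldType) (V : lmodType K) (n k : nat)
    (br : n.-tuple V -> V) (a : k.-tuple V) : (n - k).-tuple V -> V :=
  fun x => br (args n (a ++ x)).

Lemma twist_k_subproof (n k : nat) (i : 'I_(n - k).-1) : (k + i < n.-1)%N.
Proof. by case: i => i /= hi; rewrite -ltn_subRL -subn1 subnAC subn1. Qed.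

Definition twist_k (K : fieldType) (V : lmodType K) (n k : nat)
    (alpha : 'I_n.-1 -> {linear V -> V}) : 'I_(n - k).-1 -> {linear V -> V} :=
  fun i => alpha (Ordinal (twist_k_subproof i)).

Arguments twist_k {K V n} k alpha.

(* Main.v *)
Require Import Defs.
From mathcomp Require Import all_boot all_order all_algebra.
From mathcomp Require Import zify.

Import GRing.Theory.
Local Open Scope ring_scope.

(** Put x = (a_1, ..., a_k, x_{k+1}, ..., x_{n-1}) and
    y = (a_1, ..., a_k, y_{k+1}, ..., y_n) in the Hom-Nambu identity of L.
    Since the a_i are fixed by the twisting maps, the left-hand side is that of
    the identity for L_k.  For i <= k, the i-th summand on the right contains
    the entry [a_1, ..., a_k, x_{k+1}, ..., x_{n-1}, a_i] = 0 and vanishes by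
    multilinearity; the other summands are those of the identity for L_k. *)

Lemma tnth_args {K : fieldType} {V : lmodType K} {n : nat} (s : seq V)
  (i : 'I_n) : tnth (args n s) i = s`_i.
Proof. by rewrite tnth_mktuple. Qed.

Lemma val_args {K : fieldType} {V : lmodType K} {n : nat} (s : seq V) :
  size s = n -> args n s = s :> seq V.
Proof.
move=> sz_s; apply: (@eq_from_nth _ 0) => [|i]; rewrite size_tuple // => lt_in.
by rewrite -[i]/(val (Ordinal lt_in)) -tnth_nth tnth_args.
Qed.

Lemma multilinear0 {K : fieldType} {V : lmodType K} {n : nat}
    {br : n.-tuple V -> V} (br_lin : multilinear br)
    (t : n.-tuple V) (i : 'I_n) :
  tnth t i = 0 -> br t = 0.
Proof.
(* With scalar [-1] and both vectors zero, linearity in slot [i] reads f(0) = -f(0) + f(0) = 0. *)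
move=> ti0; have := br_lin i t (-1) 0 0.
rewrite scaler0 addr0 scaleN1r addNr => <-; congr br.
by apply: eq_from_tnth => j; rewrite tnth_mktuple; case: eqP => // ->.
Qed.

(** Slot [i] of the restricted bracket is slot [k + i] of [br], so linearity is inherited slot by
    slot. *)
Lemma multilinear_bracket_k {K : fieldType} {V : lmodType K} {n k : nat}
    {br : n.-tuple V -> V} (a : k.-tuple V) :
  (k <= n)%N -> multilinear br -> multilinear (bracket_k br a).
Proof.
move=> le_kn br_lin i x.
have lt_in : (k + i < n)%N by rewrite -ltn_subRL.
pose i' := Ordinal lt_in.
have E v : bracket_k br a [tuple if j == i then v else tnth x j | j < n - k] =
    br [tuple if j == i' then v else tnth (args n (a ++ x)) j | j < n].
  congr br; apply: eq_from_tnth => j.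
  rewrite tnth_args tnth_mktuple tnth_args !nth_cat size_tuple -val_eqE /=.
  case: ltnP => [lt_jk|le_kj]; first by case: eqP => // ej; lia.
  have lt_j : (j - k < n - k)%N by have := ltn_ord j; lia.
  rewrite -[(j - k)%N]/(val (Ordinal lt_j)) nth_mktuple -val_eqE /=.
  by rewrite (tnth_nth 0) /=; congr (if _ then _ else _); lia.
by move=> c u v; rewrite !E br_lin.
Qed.

Lemma hom_nambu_identity_bracket_k {K : fieldType} {V : lmodType K}
    {n k : nat} {br : n.-tuple V -> V} {alpha : 'I_n.-1 -> {linear V -> V}}
    (a : k.-tuple V) (lt_kn : (k < n)%N) (br_lin : multilinear br)
    (a_fixed : forall i : 'I_n.-1, (i < k)%N -> alpha i a`_i = a`_i)
    (a_zero : forall (j : 'I_k) (x : (n.-1 - j.+1).-tuple V),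
      br (args n (take j.+1 a ++ x ++ [:: a`_j])) = 0) :
  hom_nambu_identity br alpha ->
  hom_nambu_identity (bracket_k br a) (twist_k k alpha).
Proof.
move=> br_id x y.
have sz_ax : size (a ++ x) = n.-1 by rewrite size_cat !size_tuple; lia.
have val_rcons (z : (n - k).-1.-tuple V) v :
    args (n - k) (rcons z v) = rcons z v :> seq V.
  by rewrite val_args // size_rcons size_tuple; lia.
have := br_id (args n.-1 (a ++ x)) (args n (a ++ y)).
set lhs := br _ => id_axy.
transitivity lhs.
  (* Left-hand sides, entry by entry: the last entries coincide, the entries of [a] are fixed by
     their twisting maps, and the entries of [x] meet the same maps after the shift by [k]. *)
  congr br; apply: eq_from_tnth => j; rewrite !tnth_args.
  rewrite val_rcons -rcons_cat !nth_rcons size_cat !size_tuple.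
  have -> : (k + (n - k).-1)%N = n.-1 by lia.
  case: ltnP => // lt_j; rewrite nth_cat size_tuple.
  rewrite -[X in _ = nth 0 _ X]/(val (Ordinal lt_j)) nth_mktuple tnth_args /=.
  rewrite nth_cat size_tuple.
  case: ltnP => [lt_jk|le_kj]; first by rewrite a_fixed.
  have lt_jk : (j - k < (n - k).-1)%N by lia.
  rewrite -[X in nth 0 _ X]/(val (Ordinal lt_jk)) nth_mktuple (tnth_nth 0).
  by congr (alpha _ _); apply: val_inj => /=; lia.
rewrite {}id_axy {lhs}.
have en : (k + (n - k) = n)%N by lia.
(* Reading [n] as [k + (n - k)] lets [big_split_ord] separate the summands indexed by [a] from those
   indexed by [y]. *)
rewrite (reindex (cast_ord en)); last first.
  by exists (cast_ord (esym en)) => i _; rewrite ?cast_ordK ?cast_ordKV.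
rewrite big_split_ord big1 => [|i _].
  rewrite [LHS]add0r.
  apply: eq_bigr => i _; congr br; apply: eq_from_tnth => j.
  rewrite tnth_mktuple /bracket_k val_rcons -rcons_cat !tnth_args.
  rewrite (val_args _ sz_ax) !nth_cat size_tuple.
  rewrite [val (cast_ord _ _)]/= [(k + i < k)%N]ltnNge leq_addr addKn.
  case: ltnP => [lt_jk|le_kj].
    (* Here [j < k <= k + i]: the position lies before the inner bracket, so [unlift] keeps its
       index and the twisting map fixes the entry of [a]. *)
    case: unliftP => [j' ej|ej].
      have ej' : j = j' :> nat.
        by move: lt_jk (congr1 val ej); rewrite /= /bump; lia.
      by rewrite ej' a_fixed // -ej'.
    by move: (congr1 val ej) => /=; lia.
  have lt_j : (j - k < n - k)%N by have := ltn_ord j; lia.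
  rewrite -[(j - k)%N]/(val (Ordinal lt_j)) nth_mktuple /=.
  (* Skipping [k + i] among all positions matches skipping [i] among the last [n - k]: the mixed
     cases are contradictory, and otherwise [j1 = k + j2]. *)
  case: unliftP => [j1 /(congr1 val)|/(congr1 val)] /= ej;
    case: unliftP => [j2 /(congr1 val)|/(congr1 val)] /= ej2;
    rewrite ?(tnth_nth 0) //; move: ej ej2; rewrite /bump; try lia.
  by move=> ej ej2; congr (alpha _ _); apply: val_inj => /=; lia.
(* It remains to kill the summands with [i < k], through their inner bracket in slot [i]. *)
apply: (multilinear0 br_lin _ (cast_ord en (lshift (n - k) i))).
rewrite tnth_mktuple unlift_none (val_args _ sz_ax) tnth_args nth_cat.
rewrite size_tuple /= ltn_ord.
(* [a_zero] at [i] prescribes only the first [i.+1] entries of [a]; the later ones join [x] as its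
   free arguments. *)
have sz : size (drop i.+1 a ++ x) == (n.-1 - i.+1)%N.
  by rewrite size_cat size_drop !size_tuple; have := ltn_ord i; lia.
rewrite -[RHS](a_zero i (Tuple sz)) /=; congr (br (args n _)).
by rewrite -cats1 -{1}(cat_take_drop i.+1 a) -!catA.
Qed.

(** The common twisting map agrees with each [alpha i], hence fixes every entry of [a]; applied to
    [a ++ x], it acts on [x] alone. *)
Lemma hom_multiplicative_bracket_k {K : fieldType} {V : lmodType K}
    {n k : nat} {br : n.-tuple V -> V} {alpha : 'I_n.-1 -> {linear V -> V}}
    (a : k.-tuple V) (lt_kn : (k < n)%N)
    (a_fixed : forall i : 'I_n.-1, (i < k)%N -> alpha i a`_i = a`_i) :
  hom_multiplicative br alpha ->
  hom_multiplicative (bracket_k br a) (twist_k k alpha).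
Proof.
case=> alpha0 alphaE alpha0_br; exists alpha0 => [i v|x]; first exact: alphaE.
rewrite /bracket_k alpha0_br; congr br; apply: eq_from_tnth => j.
rewrite tnth_map !tnth_args !nth_cat size_tuple.
case: ltnP => [lt_jk|le_kj].
  have lt_j : (j < n.-1)%N by lia.
  by rewrite -(alphaE (Ordinal lt_j)) (a_fixed (Ordinal lt_j)).
by rewrite (nth_map 0) // size_tuple; have := ltn_ord j; lia.
Qed.

Theorem corollary6p4 (K : fieldType) (charK0 : [pchar K] =i pred0)
    (L : lmodType K) (n : nat) (hn : (3 <= n)%N)
    (br : n.-tuple L -> L) (alpha : 'I_n.-1 -> {linear L -> L})
    (hL : hom_nambu_algebra br alpha)
    (k : nat) (hk : (1 <= k <= n - 2)%N) (a : k.-tuple L)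
    (ha_fixed : forall i : 'I_n.-1, (i < k)%N -> alpha i a`_i = a`_i)
    (ha_zero : forall (j : 'I_k) (x : (n.-1 - j.+1).-tuple L),
      br (args n (take j.+1 a ++ x ++ [:: a`_j])) = 0) :
  hom_nambu_algebra (bracket_k br a) (twist_k k alpha) /\
  (hom_multiplicative br alpha ->
   hom_multiplicative (bracket_k br a) (twist_k k alpha)).
Proof.
case: hL => _ br_lin br_id; have lt_kn : (k < n)%N by lia.
split; last exact: hom_multiplicative_bracket_k.
(* The bound [k <= n - 2] gives arity at least 2. *)
split; first by lia.
- exact: multilinear_bracket_k (ltnW lt_kn) br_lin.
- exact: hom_nambu_identity_bracket_k.
Qed.
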